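(* Let $\mu$ be a cardinal and $\lambda=\mu^+$. Suppose that: (a) $\lambda=\mu^+=2^\mu$ and $\mu=\mu^{<\mu}$; (b) $S^*\subseteq\{\alpha<\lambda:\mathrm{cf}\,\alpha=\mu\}$, and $\overline C=\langle c_\delta:\delta\in S^*\rangle$ is a sequence such that for each $\delta\in S^*$, $\delta=\sup c_\delta$ and $c_\delta$ is a closed set of limit ordinals; (c) for every $\delta\in S^*$ and every $\alpha\in\mathrm{nacc}\,c_\delta$ there is a family $P_{\delta,\alpha}\subseteq\mathcal P(\alpha)$ with $|P_{\delta,\alpha}|\le\mathrm{cf}\,\alpha$, and if moreover $\alpha\in S^*$ then $|P_{\delta,\alpha}|<\mu$; (d) for every set $A\subseteq\lambda$ and every club $E\subseteq\lambda$ there is a stationary set $S_{A,E}\subseteq S^*$ such that for every $\delta\in S_{A,E}$, $$\delta=\sup\{\alpha\in\mathrm{nacc}\,c_\delta:\ A\cap\alpha\in P_{\delta,\alpha}\ \text{and}\ \alpha\in E\};$$ (e) if $\delta,\delta^*\in S^*$ and $\delta\in\mathrm{acc}\,c_{\delta^*}$, then there is some $\alpha<\delta$ such that $\mathrm{nacc}\,c_\delta\cap(\alpha,\delta)=\mathrm{nacc}\,c_{\delta^*}\cap(\alpha,\delta)$ and $P_{\delta,\beta}=P_{\delta^*,\beta}$ for every $\beta$ in this set (i.e. $\langle P_{\delta,\beta}:\beta\in\mathrm{nacc}\,c_\delta,\ \beta>\alpha\rangle=\langle P_{\delta^*,\beta}:\beta\in\mathrm{nacc}\,c_{\delta^*}\cap\delta,\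 \beta>\alpha\rangle$); (f) for every $\gamma<\lambda$, $\bigl|\{\langle P_{\delta,\alpha}:\alpha\in\mathrm{nacc}\,c_\delta\cap\gamma\rangle:\delta\in S^*\}\bigr|\le\mu$. Then there is a $\mu$-complete Souslin tree on $\lambda$.
   Context: For a set of ordinals $C$, $\mathrm{acc}\,C$ denotes the set of accumulation points of $C$ (ordinals $\alpha$ with $\alpha=\sup(C\cap\alpha)>0$, i.e. limits of elements of $C$ that are themselves in the closure) and $\mathrm{nacc}\,C=C\setminus\mathrm{acc}\,C$. A Souslin tree on $\lambda$ is a tree whose underlying set is $\lambda$, of height $\lambda$, with no chain and no antichain of cardinality $\lambda$. A tree is $\mu$-complete if every increasing sequence of elements of the tree of length less than $\mu$ has an upper bound in the tree. *)

(* Defs.v *)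
From HB Require Import structures.
From mathcomp Require Import all_boot all_order.
From mathcomp Require Import boolp classical_sets functions cardinality.

(* The ordinals below lambda are the elements of a type L : orderType d whose
   order is well-founded and has order type lambda; an ordinal a : L is
   identified, as a von Neumann ordinal, with the set [below a] of its
   predecessors, and lambda itself with [set: L]. *)

Set Implicit Arguments.
Unset Strict Implicit.
Unset Printing Implicit Defensive.
Import Order.TTheory.

Local Open Scope order_scope.
Local Open Scope classical_set_scope.
Local Open Scope card_scope.

Definition card_lt (T U : Type) (A : set T) (B : set U) : Prop :=
  A #<= B /\ ~ (B #<= A).

Section Ordinals.
Context {d : Order.disp_t} {L : orderType d}.
Implicit Types (a b k delta mu : L) (A C E S : set L) (T : L -> L -> Prop).

Definition below a : set L := [set x | x < a].

Definition well_ordered : Prop := well_founded (fun x y : L => x < y).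

Definition infinite_cardinal mu : Prop :=
  infinite_set (below mu) /\ forall a, a < mu -> card_lt (below a) (below mu).

(* L has the order type of the least ordinal of cardinality greater than mu. *)
Definition is_successor_cardinal mu : Prop :=
  card_lt (below mu) [set: L] /\ forall a, below a #<= below mu.

(* The set of all sequences of length less than mu of elements of mu. *)
Definition short_sequences mu : Type :=
  {a : below mu & below (\val a) -> below mu}.

Definition limit_ordinal a : Prop :=
  (exists b, b < a) /\ forall b, b < a -> exists2 c, b < c & c < a.

Definition cofinal_map k a : Prop := exists f : L -> L,
  (forall x, x < k -> f x < a) /\
  (forall b, b < a -> exists2 x, x < k & b <= f x).

(* The default value of [xget] is never used when L is well-ordered, since the
   identity is a cofinal map from a to a. *)
Definition cf a : L :=
  xget a [set k | cofinal_map k a /\ forall j, cofinal_map j a -> k <= j].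

(* [acc C] is not required to be included in C; in particular it contains
   delta when C is an unbounded subset of a limit ordinal delta. *)
Definition acc C : set L :=
  [set a | (exists b, b < a) /\ supremums (C `&` below a) a].

Definition nacc C : set L := C `\` acc C.

Definition closed_in C delta : Prop :=
  forall a, a < delta -> acc C a -> C a.

Definition club E : Prop :=
  (forall a, exists2 b, E b & a < b) /\ acc E `<=` E.

Definition stationary S : Prop := forall E, club E -> (S `&` E) !=set0.

(* The sequence < P delta a : a in nacc (c delta) /\ a < gamma >, as a set of
   ordered pairs. *)
Definition restr_seq (c : L -> set L) (P : L -> L -> set (set L)) delta
    (gamma : L) : set (L * set (set L)) :=
  [set (a, P delta a) | a in nacc (c delta) `&` below gamma].

Definition preds T (x : L) : set L := [set y | T y x].

Definition is_tree T : Prop :=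
  [/\ forall x, ~ T x x,
      forall x y z, T x y -> T y z -> T x z
    & forall (x : L) (X : set L), X `<=` preds T x -> X !=set0 ->
        exists2 m, X m & forall y, X y -> y = m \/ T m y].

Definition node_height T (x : L) a : Prop := exists f : L -> L,
  set_bij (preds T x) (below a) f /\
  forall y z, T y x -> T z x -> (T y z <-> f y < f z).

(* The height of a tree is the least ordinal a such that no node has height a,
   here lambda. *)
Definition full_height T : Prop :=
  (forall x, exists a, node_height T x a) /\
  (forall a, exists x, node_height T x a).

Definition tree_comparable T (x y : L) : Prop := [\/ x = y, T x y | T y x].

Definition tree_chain T A : Prop :=
  forall x y, A x -> A y -> tree_comparable T x y.

Definition tree_antichain T A : Prop :=
  forall x y, A x -> A y -> x <> y -> ~ tree_comparable T x y.

Definition souslin_tree T : Prop :=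
  [/\ is_tree T,
      full_height T,
      forall A, tree_chain T A -> ~ (A #= [set: L])
    & forall A, tree_antichain T A -> ~ (A #= [set: L])].

Definition complete_tree mu T : Prop :=
  forall k, k < mu -> forall s : L -> L,
    (forall i j, i < j -> j < k -> T (s i) (s j)) ->
    exists x, forall i, i < k -> s i = x \/ T (s i) x.

End Ordinals.

Arguments well_ordered {d} L.

(* Main.v *)
Require Import Defs.
From HB Require Import structures.
From mathcomp Require Import all_boot all_order.
From mathcomp Require Import boolp classical_sets functions cardinality.

Set Implicit Arguments.
Unset Strict Implicit.
Unset Printing Implicit Defensive.
Import Order.TTheory.

Local Open Scope order_scope.
Local Open Scope classical_set_scope.
Local Open Scope card_scope.

(** The nodes of the tree are pairs (a, X) with X a subset of the ordinal a,
    ordered by end extension, and its levels T_a, each of size at most mu, are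
    chosen by recursion on a. If cf a < mu, all branches through the levels below
    a are continued; this costs only mu^{<mu} = mu nodes and yields
    mu-completeness. If cf a = mu and a is in S*, only those branches are
    continued that from some point on follow c_a: at each b in nacc c_a the
    branch passes through a node of T_b chosen as a function of the previous
    node and of P_{a,b} alone, and lying above an element of every dense set
    coded in P_{a,b}. If cf a = mu and a is not in S*, the branches following the
    initial segments of the c_delta are continued, as well as, for each node and
    each P_{delta,a}, one branch through it hitting the dense sets coded in
    P_{delta,a}; by (f) these are at most mu branches. Coherence (e) ensures that
    a branch following c_delta is never stopped at an accumulation point of
    c_delta.

    Given a dense set D of nodes, (d) yields delta such that D is guessed
    cofinally often in nacc c_delta, so that every node of level delta is above
    an element of D. Applied to the nodes that are below no element of a given
    chain, or to the nodes that are above some element of a given antichain or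
    incompatible with all of them, this bounds the heights of the elements of
    the chain or antichain by delta. *)

Lemma card_le_exP (T U : Type) (A : set T) (B : set U) : inhabited U ->
  A #<= B <-> exists f : T -> U, (forall x, A x -> B (f x)) /\
    (forall x y, A x -> A y -> f x = f y -> x = y).
Proof.
elim/Ppointed: U => U in B *; first by case=> u; case: (no u).
move=> _; split.
  move=> /pcard_leP/injfunPex[f fAB finj]; exists f; split=> // x y Ax Ay.
  by apply: finj; apply: mem_set.
move=> [f [fAB finj]]; apply/pcard_leP/injfunPex; exists f => // x y.
by move=> /set_mem Ax /set_mem Ay; apply: finj.
Qed.

Lemma card_eq_exP (T U : Type) (A : set T) (B : set U) : inhabited U ->
  A #= B -> exists f : T -> U, set_bij A B f.
Proof.
elim/Ppointed: U => U in B *; first by case=> u; case: (no u).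
by move=> _ /card_set_bijP.
Qed.

(** * Well-orders: suprema, recursion, cofinality, collapse *)

Section WellOrder.
Context {d : Order.disp_t} {L : orderType d}.
Hypothesis hwo : well_ordered L.
Implicit Types (a b k m : L).

Lemma wo_min (A : set L) a : A a -> exists2 m, A m & forall b, A b -> m <= b.
Proof.
move=> Aa; apply: contrapT => H.
have : forall b, ~ A b; last by move=> /(_ a).
elim/(well_founded_ind hwo) => b IH Ab; apply: H; exists b => // x Ax.
by rewrite leNgt; apply/negP => /IH.
Qed.

Lemma wo_sup (A : set L) b : (forall x, A x -> x <= b) ->
  exists s, supremums A s.
Proof.
by move=> /(@wo_min [set y | forall x, A x -> x <= y])[s As minS]; exists s.
Qed.

Lemma sup_lt (A : set L) s b : supremums A s -> b < s ->
  exists2 x, A x & b < x.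
Proof.
move=> [_ lubs] bs; apply: contrapT => H.
have : s <= b.
  by apply: lubs => x Ax; rewrite leNgt; apply/negP => bx; apply: H; exists x.
by rewrite leNgt bs.
Qed.

Lemma sup_ge (A : set L) s x : supremums A s -> A x -> x <= s.
Proof. by move=> [+ _] => /[apply]. Qed.

Lemma sup_le (A : set L) s b : supremums A s -> (forall x, A x -> x <= b) ->
  s <= b.
Proof. by move=> [_ +] => /[apply]. Qed.

Lemma sup_unique (A : set L) s t : supremums A s -> supremums A t -> s = t.
Proof.
by move=> [us ls] [ut lt]; apply/le_anti/andP; split; [apply: ls|apply: lt].
Qed.

(** [G] is fed a total function, cut off to [u0] outside [below a], so that recursive definitions
    carry no proof arguments. *)
Lemma wf_rec (U : Type) (u0 : U) (G : L -> (L -> U) -> U) :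
  exists f, forall a, f a = G a (fun b => if b < a then f b else u0).
Proof.
pose step a (rec : forall b, b < a -> U) :=
  G a (fun b => match @idP (b < a) with
                | ReflectT h => rec b h | ReflectF _ => u0 end).
exists (Fix hwo (fun _ => U) step) => a.
rewrite Fix_eq.
  rewrite {1}/step; congr (G a _); apply/funext => b.
  by case: {-}_ / (@idP (b < a)) => h //;
    [rewrite h|rewrite (negbTE (introN idP h))].
move=> x f g fg; rewrite /step; congr (G x _); apply/funext => b.
by case: {-}_ / (@idP (b < x)) => h.
Qed.

(** Transfinite dependent choice: [xget] picks each value among those [R] allows. The first
    hypothesis, that [R i] sees [f] below [i] only, removes the cut-off of [wf_rec]. *)
Lemma wf_choice (U : choiceType) (u0 : U) k (R : L -> (L -> U) -> U -> Prop) :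
  (forall i f g, (forall j, j < i -> f j = g j) -> R i f `<=` R i g) ->
  (forall i f, i < k -> (forall j, j < i -> R j f (f j)) -> exists u, R i f u) ->
  exists f, forall i, i < k -> R i f (f i).
Proof.
move=> Rext Rex; have [f fE] := wf_rec u0 (fun i f => xget u0 (R i f)).
exists f; elim/(well_founded_ind hwo) => i IH ik.
have [|u Ru] := Rex i f ik.
  by move=> j ji; apply: IH => //; exact: lt_trans ik.
rewrite fE; set g := fun b => _.
have /Rext : forall j, j < i -> g j = f j by move=> j ji; rewrite /g ji.
apply; apply: (@xgetI _ _ _ u); apply: Rext Ru => j ji.
by rewrite /g ji.
Qed.

Lemma cofinal_map_id a : cofinal_map a a.
Proof. by exists id; split=> // b ba; exists b. Qed.

Lemma cf_cofinal a : cofinal_map (cf a) a /\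
  forall k, cofinal_map k a -> cf a <= k.
Proof.
apply: (@xgetPex _ a
  [set k | cofinal_map k a /\ forall j, cofinal_map j a -> k <= j]).
have [m cm minm] := @wo_min [set k | cofinal_map k a] a (cofinal_map_id a).
by exists m.
Qed.

Lemma cf_le a k : cofinal_map k a -> cf a <= k.
Proof. by apply: (cf_cofinal a).2. Qed.

(* h is the Mostowski collapse of A. *)
Lemma collapse (A : set L) m : A `<=` below m ->
  exists (k : L) (h : L -> L), [/\ k <= m, forall x, A x -> h x < k,
    forall x y, A x -> A y -> h x = h y -> x = y &
    forall j, j < k -> exists2 x, A x & h x = j].
Proof.
move=> Am.
pose R x (h : L -> L) := fun u => (forall y, A y -> y < x -> h y < u) /\
  forall v, (forall y, A y -> y < x -> h y < v) -> u <= v.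
have [h hE] := wf_rec m (fun x h => xget m (R x h)).
have hP x : x < m -> R x h (h x) /\ h x <= x.
  elim/(well_founded_ind hwo): x => x IH xm.
  have hx y : A y -> y < x -> h y < x.
    by move=> Ay yx; apply: (le_lt_trans _ yx); apply: (IH y yx (lt_trans yx xm)).2.
  have [u ub minu] := @wo_min [set u | forall y, A y -> y < x -> h y < u] x hx.
  have -> : h x = u.
    rewrite hE; apply: xget_unique.
      split=> [y Ay yx|v H]; first by rewrite yx; apply: ub.
      by apply: minu => y Ay yx; have := H y Ay yx; rewrite yx.
    move=> v [v1 v2]; apply/le_anti/andP; split.
      by apply: v2 => y Ay yx; rewrite yx; apply: ub.
    by apply: minu => y Ay yx; have := v1 y Ay yx; rewrite yx.
  by split; [split=> // v H; apply: minu|apply: minu].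
have [k kub mink] := @wo_min [set k | forall y, A y -> h y < k] m
  (fun y Ay => le_lt_trans (hP y (Am _ Ay)).2 (Am _ Ay)).
exists k, h; split=> //.
- by apply: mink => y Ay; apply: le_lt_trans (hP y (Am _ Ay)).2 (Am _ Ay).
- move=> x y Ax Ay hxy; case: (ltgtP x y) => // xy.
    by have := (hP y (Am _ Ay)).1.1 _ Ax xy; rewrite hxy ltxx.
  by have := (hP x (Am _ Ax)).1.1 _ Ay xy; rewrite hxy ltxx.
(* A missed value [j] would, by induction, bound all values of [h], against the minimality of
   [k]. *)
move=> j jk; apply: contrapT => H.
have Hj x : A x -> h x < j.
  elim/(well_founded_ind hwo): x => x IH Ax.
  have : h x <= j by apply: (hP x (Am _ Ax)).1.2 => y Ay yx; apply: IH.
  by rewrite le_eqVlt => /orP[/eqP E|//]; case: H; exists x.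
by have := mink j Hj; rewrite leNgt jk.
Qed.

End WellOrder.

(** * Sets of cardinality at most mu, and the regularity of lambda *)

Section Cardinals.
Context {d : Order.disp_t} {L : orderType d}.
Variable mu : L.
Implicit Types (a b k : L).

Definition small (T : Type) (A : set T) : Prop := exists f : T -> L,
  (forall x, A x -> f x < mu) /\
  (forall x y, A x -> A y -> f x = f y -> x = y).

Lemma smallE (T : Type) (A : set T) : A #<= below mu <-> small A.
Proof. exact: (card_le_exP A (below mu) (inhabits mu)). Qed.

Lemma small_sub (T : Type) (A B : set T) : A `<=` B -> small B -> small A.
Proof.
move=> AB [f [fm finj]]; exists f; split=> [x /AB/fm //|x y /AB Bx /AB By].
exact: finj.
Qed.

Lemma small_inj (T U : Type) (A : set T) (B : set U) (h : T -> U) :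
  (forall x, A x -> B (h x)) ->
  (forall x y, A x -> A y -> h x = h y -> x = y) -> small B -> small A.
Proof.
move=> hAB hinj [f [fm finj]]; exists (f \o h); split=> [x /hAB/fm //|x y Ax Ay].
by move=> /(finj _ _ (hAB _ Ax) (hAB _ Ay)); apply: hinj.
Qed.

(** It is enough that each element of [A] has some code in [B] from which it can be recovered; the
    choice of codes is made here. *)
Lemma small_rel (T U : Type) (A : set T) (B : set U) (R : T -> U -> Prop) :
  (forall x, A x -> exists2 y, B y & R x y) ->
  (forall x x' y, A x -> A x' -> R x y -> R x' y -> x = x') ->
  small B -> small A.
Proof.
move=> ex un [f [fm finj]].
have /choice[g gP] : forall x, exists l, A x -> exists y, [/\ B y, R x y & l = f y].
  move=> x; have [Ax|NA] := pselect (A x); last by exists mu.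
  by have [y By Rxy] := ex x Ax; exists (f y) => _; exists y.
exists g; split=> [x /gP[y [By _ ->]]|x x' Ax Ax']; first exact: fm.
have [y [By Rxy ->]] := gP x Ax; have [y' [By' Rxy' ->]] := gP x' Ax'.
by move=> /(finj _ _ By By') E; apply: (un x x' y) => //; rewrite E.
Qed.

Lemma small_image (T U : Type) (A : set T) (h : T -> U) :
  small A -> small (h @` A).
Proof.
apply: (@small_rel _ _ _ _ (fun y x => h x = y)).
  by move=> y [x Ax <-]; exists x.
by move=> y y' x _ _ <- <-.
Qed.

Hypothesis hwo : well_ordered L.
Hypothesis hmu : infinite_cardinal mu.
Hypothesis hlambda : is_successor_cardinal mu.
Hypothesis ha2 : [set: short_sequences mu] #= below mu.

Lemma small_below a : small (below a).
Proof. by apply/smallE; apply: hlambda.2. Qed.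

Lemma not_small_setT : ~ small [set: L].
Proof. by move=> /smallE; apply: hlambda.1.2. Qed.

(** Two positions below some [k < mu] let a sequence of length [k] store a pair; they also serve as
    codes for the two truth values. *)
Lemma two_below_mu : exists k x y, [/\ k < mu, x < k, y < k & x <> y].
Proof.
have ninf (s : seq L) : exists2 x, x < mu & x \notin s.
  apply: contrapT => H; apply: hmu.1; apply: (@sub_finite_set _ _ [set` s]).
    move=> x xm /=; apply: contrapT => xs; apply: H; exists x => //.
    exact/negP.
  exact: finite_seq.
have [x xm _] := ninf [::]; have [y ym yx] := ninf [:: x].
have [z zm zxy] := ninf [:: x; y]; move: yx zxy; rewrite !inE negb_or.
move=> yx /andP[zx zy].
wlog xy : x y xm ym yx zx zy / x < y.
  move=> H; case: (ltgtP x y) => [xy|xy|xy]; first exact: (H x y).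
    by apply: (H y x) => //; rewrite eq_sym.
  by rewrite xy eqxx in yx.
case: (ltgtP z y) zy => // [zy|yz] _.
  exists y, x, z; split=> //; apply/eqP; by rewrite eq_sym.
by exists z, x, y; split=> //; [exact: lt_trans yz|apply/eqP; rewrite eq_sym].
Qed.

(** This is mu^{<mu} = mu in the form used below: total functions stand for sequences of length [k],
    and only their values below [k] count. *)
Lemma code_fun k : k < mu -> exists e : (L -> L) -> L,
  (forall f, (forall x, x < k -> f x < mu) -> e f < mu) /\
  (forall f g, (forall x, x < k -> f x < mu) -> (forall x, x < k -> g x < mu) ->
     e f = e g -> forall x, x < k -> f x = g x).
Proof.
move=> km.
have [e [em einj]] : small [set: short_sequences mu].
  by apply/smallE; move/card_eqPle: ha2 => [].
pose kk : below mu := SigSub (mem_set (km : below mu k)).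
pose m0 : below mu := kk.
pose tr (f : L -> L) : short_sequences mu :=
  @Tagged _ kk (fun a : below mu => below (\val a) -> below mu)
    (fun x => insubd m0 (f (\val x))).
have trE (f : L -> L) x (xk : x < k) : f x < mu ->
    \val (tagged (tr f) (SigSub (mem_set (xk : below k x)))) = f x.
  move=> fx; rewrite /= val_insubd; case: ifP => //.
  by rewrite mem_set.
exists (e \o tr); split=> [f fm|f g fm gm /= /(einj _ _ I I) E x xk].
  exact: em.
rewrite -(trE f x xk (fm _ xk)) -(trE g x xk (gm _ xk)).
by rewrite (eq_from_Tagged (E : @Tagged _ kk _ (tagged (tr f)) =
                                @Tagged _ kk _ (tagged (tr g)))).
Qed.

(** A pair becomes the sequence of length [k] with the first code at [x] and the second elsewhere,
    so mu^{<mu} = mu gives the bound. *)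
Lemma small_setX (T U : Type) (A : set T) (B : set U) :
  small A -> small B -> small (A `*` B).
Proof.
move=> [f [fm finj]] [g [gm ginj]].
have [k [x [y [km xk yk xy]]]] := two_below_mu.
have [e [em einj]] := code_fun km.
pose h (p : T * U) (z : L) := if z == x then f p.1 else g p.2.
have hm p : (A `*` B) p -> forall z, z < k -> h p z < mu.
  by move=> [/fm ? /gm ?] z _; rewrite /h; case: ifP.
exists (e \o h); split=> [p Ap|p q Ap Aq /= E]; first exact/em/hm.
have {}E := einj _ _ (hm _ Ap) (hm _ Aq) E.
have := E x xk; rewrite /h eqxx => /(finj _ _ Ap.1 Aq.1) E1.
have := E y yk; rewrite /h eq_sym (introF eqP xy) => /(ginj _ _ Ap.2 Aq.2) E2.
by case: p q E1 E2 {E Ap Aq} => [? ?] [? ?] /= -> ->.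
Qed.

Lemma small_bigcup (I T : Type) (D : set I) (F : I -> set T) :
  small D -> (forall i, D i -> small (F i)) -> small (\bigcup_(i in D) F i).
Proof.
move=> sD sF.
have /choice[f fP] : forall i, exists f : T -> L, D i ->
    (forall x, F i x -> f x < mu) /\
    (forall x y, F i x -> F i y -> f x = f y -> x = y).
  move=> i; have [Di|] := pselect (D i); last by exists (fun=> mu).
  by have [f fP] := sF i Di; exists f.
apply: (@small_rel _ _ _ (D `*` below mu)
   (fun x p => [/\ D p.1, F p.1 x & f p.1 x = p.2])).
- move=> x [i Di Fx]; exists (i, f i x) => //; split=> //=.
  exact: (fP i Di).1.
- by move=> x x' p _ _ [Dp Fx E] [_ Fx' E']; apply: (fP _ Dp).2 => //; rewrite E E'.
exact/small_setX/small_below.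
Qed.

Lemma small_Prop : small [set: Prop].
Proof.
have [k [x [y [km xk yk xy]]]] := two_below_mu.
exists (fun p : Prop => if `[< p >] then x else y); split.
  by move=> p _; case: ifP => _; [apply: lt_trans km|apply: lt_trans km].
move=> p q _ _; case: asboolP; case: asboolP => // Hq Hp E; apply/propext => //.
by case: xy.
Qed.

Lemma small_set1 (T : Type) (x : T) : small [set x].
Proof.
have [k [y [_ [km _ _ _]]]] := two_below_mu.
by exists (fun=> k); split=> // ? ? -> ->.
Qed.

Lemma small_setU (T : Type) (A B : set T) : small A -> small B -> small (A `|` B).
Proof.
move=> sA sB.
apply: (@small_sub _ _ (\bigcup_(p in [set: Prop]) if `[< p >] then A else B)).
  move=> x [Ax|Bx]; first by exists True => //; rewrite asboolT.
  by exists False => //; rewrite asboolF.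
by apply: small_bigcup => [|p _]; [exact: small_Prop|case: ifP].
Qed.

(** This is the regularity of lambda: were [f] unbounded on [A], all of [L] would be a union of at
    most mu initial segments of size at most mu. *)
Lemma small_bounded (T : Type) (A : set T) (f : T -> L) : small A ->
  exists b, forall x, A x -> f x < b.
Proof.
move=> sA; apply: contrapT => H; apply: not_small_setT.
apply: (@small_sub _ _ (\bigcup_(x in A) (below (f x) `|` [set f x]))).
  move=> y _; apply: contrapT => Hy; apply: H; exists y => x Ax.
  rewrite ltNge; apply/negP => yf; apply: Hy; exists x => //.
  by move: yf; rewrite le_eqVlt => /orP[/eqP->|]; [right|left].
apply: small_bigcup => // x _; apply: small_setU; first exact: small_below.
exact: small_set1.
Qed.

Lemma no_max a : exists b, a < b.
Proof.
by have [b /(_ a erefl)] := small_bounded id (small_set1 a); exists b.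
Qed.

Lemma cf_le_mu a : cf a <= mu.
Proof.
have [[b ba]|H] := pselect (exists b, b < a); last first.
  apply: le_trans (cf_le hwo (cofinal_map_id a)) _.
  by rewrite leNgt; apply/negP => ma; apply: H; exists mu.
apply: cf_le => //; have [f [fm finj]] := small_below a.
(* The inverse of an injection of [a] into [mu], with default [b] off its range, maps [mu] onto
   [a]. *)
exists (fun i => xget b [set x | x < a /\ f x = i]); split.
  by move=> x xm; case: xgetP => [y _ [] //|H].
move=> x xa; exists (f x); first exact: fm.
case: xgetP => [y _ [ya /(finj _ _ ya xa) ->] //|/(_ x) []]; by split.
Qed.

(** The collapse of an injective image of [A] in [mu] has order type [k <= mu], and [k = mu] would
    invert to an injection of [below mu] into [A]. *)
Lemma small_enum (T : Type) (A : set T) : card_lt A (below mu) ->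
  exists k (f : T -> L), [/\ k < mu, forall x, A x -> f x < k &
    forall x y, A x -> A y -> f x = f y -> x = y].
Proof.
move=> [/smallE[f [fm finj]] nle].
have [_ [x /fm fx <-] //|k [h [km hk hinj hsurj]]] :=
  collapse hwo (A := f @` A) (m := mu).
have hfinj x y : A x -> A y -> h (f x) = h (f y) -> x = y.
  move=> Ax Ay /(hinj _ _ (ex_intro2 _ _ x Ax erefl) (ex_intro2 _ _ y Ay erefl)).
  exact: finj.
exists k, (h \o f); split=> //; last by move=> x Ax; apply: hk; exists x.
rewrite lt_neqAle km andbT; apply/eqP => kE; apply: nle; subst k.
have [x0 Ax0] : exists x, A x.
  have [k [y [_ [km' _ _ _]]]] := two_below_mu.
  by have [_ [x Ax _] _] := hsurj k km'; exists x.
apply/(card_le_exP (below mu) A (inhabits x0)).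
have /choice[g gP] : forall j, exists x, j < mu -> A x /\ h (f x) = j.
  move=> j; have [jm|] := boolP (j < mu); last by exists x0.
  by have [_ [x Ax <-] E] := hsurj j jm; exists x.
exists g; split=> [j /gP[] //|i j /gP[_ {2}<-] /gP[_ {2}<-] -> //].
Qed.

Lemma cf_lt_succ a b : b < a -> (forall x, x < a -> x <= b) -> cf a < mu.
Proof.
move=> ba maxb; have [k [x [_ [km xk _ _]]]] := two_below_mu.
apply: le_lt_trans km; apply: cf_le => //.
by exists (fun=> b); split=> // y /maxb; exists x.
Qed.

Lemma cf_mu_limit a : cf a = mu -> limit_ordinal a.
Proof.
move=> cfa; have [k [x [_ [km _ _ _]]]] := two_below_mu.
have mua : mu <= a by rewrite -cfa; apply: cf_le => //; apply: cofinal_map_id.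
split=> [|b ba]; first by exists k; apply: lt_le_trans mua.
apply: contrapT => H; suff : cf a < mu by rewrite cfa ltxx.
apply: (cf_lt_succ ba) => y ya; rewrite leNgt; apply/negP => bY.
by apply: H; exists y.
Qed.

End Cardinals.

(** * Coding nodes by ordinals below lambda *)

Section NodeCode.
Context {d : Order.disp_t} {L : orderType d}.
Variable mu : L.
Hypothesis hwo : well_ordered L.
Hypothesis hmu : infinite_cardinal mu.
Hypothesis hlambda : is_successor_cardinal mu.
Hypothesis ha1 : [set: L] #= [set X : set L | X `<=` below mu].
Hypothesis ha2 : [set: short_sequences mu] #= below mu.

(** Both directions of 2^mu = lambda are used: [h] turns heights into subsets of mu, and [g] turns
    the subset of mu that describes a node into an ordinal. *)
Lemma node_code : exists code : L * set L -> L, forall n m,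
  n.2 `<=` below n.1 -> m.2 `<=` below m.1 -> code n = code m -> n = m.
Proof.
have [le1 le2] := (card_eqPle _ _).1 ha1.
have [h [hm hinj]] := (card_le_exP _ _ (inhabits set0)).1 le1.
have [g [_ ginj]] := (card_le_exP _ _ (inhabits mu)).1 le2.
have [f [fm finj]] : small mu ([set: Prop] `*` below mu).
  by apply: small_setX => //; [apply: small_Prop|apply: small_below].
have /choice[i iP] := small_below hlambda.
(* The disjoint union, tagged by [True] and [False], of [h n.1] and a copy of [n.2] inside mu. The
   first part recovers the height, and then [i] at that height recovers the subset. *)
pose Z (n : L * set L) : set L := [set z | (exists2 u, h n.1 u & z = f (True, u))
  \/ (exists2 u, n.2 u & z = f (False, i n.1 u))].
have fI p u p' u' : u < mu -> u' < mu -> f (p, u) = f (p', u') -> p = p' /\ u = u'.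
  by move=> um um' /finj-/(_ (conj I um) (conj I um'))[-> ->].
have TF : (True : Prop) <> False by move=> E; rewrite -E.
have im n x : n.2 `<=` below n.1 -> n.2 x -> i n.1 x < mu.
  by move=> wn nx; apply: (iP n.1).1; apply: wn.
have Zm n : n.2 `<=` below n.1 -> Z n `<=` below mu.
  move=> wn z [[u hu ->]|[u nu ->]]; apply: fm; split=> //=.
    exact: (hm n.1 I).
  exact: im.
have Z1 n m : n.2 `<=` below n.1 -> m.2 `<=` below m.1 -> Z n `<=` Z m ->
    h n.1 `<=` h m.1.
  move=> wn wm ZZ u hu.
  have um : u < mu by apply: (hm n.1 I).
  have [|[v hv /fI E]|[v mv /fI E]] := ZZ (f (True, u)); first by left; exists u.
    by have [//||_ ->] := E _ _; first exact: (hm m.1 I).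
  by have [//||/TF] := E _ _; first exact: im.
have Z2 a X Y : X `<=` below a -> Y `<=` below a -> Z (a, X) `<=` Z (a, Y) ->
    X `<=` Y.
  move=> wX wY ZZ x Xx; have ix := im (a, X) x wX Xx.
  have [|[v hv /fI E]|[v /= mv /fI E]] := ZZ (f (False, i a x)).
  - by right; exists x.
  - by have [//||/esym/TF] := E _ _; first exact: (hm a I).
  have [//||_ /(iP a).2 ->//] := E _ _; first exact: (im (a, Y)).
    exact: wX.
  exact: wY.
exists (g \o Z) => -[a X] [b Y] wX wY /ginj-/(_ (Zm _ wX) (Zm _ wY)) E.
have ab : a = b.
  apply: hinj => //; apply/seteqP; split.
    by apply: (Z1 (a, X) (b, Y)) => //; rewrite E.
  by apply: (Z1 (b, Y) (a, X)) => //; rewrite E.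
subst b; congr (_, _); apply/seteqP; split; apply: (Z2 a) => //; by rewrite E.
Qed.

End NodeCode.

(** * The recursive definition of the levels *)

Section Construction.
Context {d : Order.disp_t} {L : orderType d}.
Variables (mu : L) (Sstar : set L) (c : L -> set L) (P : L -> L -> set (set L)).
Variable code : L * set L -> L.
Implicit Types (a b q : L) (n m : L * set L) (X Y Z A : set L).
Implicit Types (N : set (L * set L)) (t : L -> set (set L)).

(* A node of height a is a pair (a, X) with X a subset of [below a]; the node
   below it of height b <= a is (b, X `&` below b). *)
Definition nle n m : Prop := n.1 <= m.1 /\ m.2 `&` below n.1 = n.2.

Definition tbelow t a : set (L * set L) := [set n | n.1 < a /\ t n.1 n.2].

Definition branches N a : set (set L) :=
  [set X | X `<=` below a /\ forall b, b < a -> N (b, X `&` below b)].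

(** Sets of nodes are given by the set [A] of their codes, because (d) guesses subsets of lambda. *)
Definition dense N A : Prop :=
  forall n, N n -> exists m, [/\ N m, nle n m & A (code m)].

Definition hits A a X : Prop :=
  exists2 b, b < a & A (code (b, X `&` below b)).

(** The choice does not depend on any delta, so branches following different [c_delta] with equal
    families choose alike; this is what lets (f) bound their number. *)
Definition choose_hit N (lev : set (set L)) a n (Q : set (set L)) : set L :=
  xget set0 [set Z | [/\ lev Z, nle n (a, Z) &
                         forall A, Q A -> dense N A -> hits A a Z]].

(** [q] is the level of the previous node: the last point of [nacc (c dl)] before [b], or the
    supremum of those points when there is no last one. *)
Definition follows t dl a X : Prop := exists2 xi, xi < a &
  forall b q, nacc (c dl) b -> b < a ->
    supremums (nacc (c dl) `&` below b) q -> xi <= q ->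
    X `&` below b = choose_hit (tbelow t b) (t b) b (q, X `&` below q) (P dl b).

Definition unbounded_in (C : set L) a : Prop :=
  forall b, b < a -> exists2 g, C g & b < g < a.

(** The empty family provides a continuation of every node even where no [P dl a] is available. *)
Definition families a : set (set (set L)) :=
  [set Q | Q = set0 \/ exists dl, [/\ Sstar dl, nacc (c dl) a & Q = P dl a]].

(** Level [a] is not yet available here, so the last clause chooses among all branches, whereas
    [follows] chooses inside the earlier levels [t b]. *)
Definition next_level a t : set (set L) :=
  [set X | branches (tbelow t a) a X /\ (cf a = mu ->
     (exists dl, [/\ Sstar dl, unbounded_in (nacc (c dl)) a, Sstar a -> dl = a &
                     follows t dl a X]) \/
     (~ Sstar a /\ exists n Q, [/\ tbelow t a n, families a Q &
        X = choose_hit (tbelow t a) (branches (tbelow t a) a) a n Q]))].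

Lemma tbelow_ext t t' a b : (forall x, x < a -> t x = t' x) -> b <= a ->
  tbelow t b = tbelow t' b.
Proof.
move=> tt' ba; apply/seteqP; split=> n [nb tn]; split=> //.
  by rewrite -tt' //; apply: lt_le_trans ba.
by rewrite tt' //; apply: lt_le_trans ba.
Qed.

Lemma follows_ext t t' dl a X : (forall x, x < a -> t x = t' x) ->
  follows t dl a X -> follows t' dl a X.
Proof.
move=> tt' [xi xia H]; exists xi => // b q nb ba sq xiq.
by rewrite -(tbelow_ext tt' (ltW ba)) -tt' //; apply: H.
Qed.

(** This removes the cut-off of [wf_rec] in [levels_exist]. *)
Lemma next_level_ext t t' a : (forall x, x < a -> t x = t' x) ->
  next_level a t = next_level a t'.
Proof.
move=> tt'; rewrite /next_level (tbelow_ext tt' (lexx a)).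
apply/seteqP; split=> X [fX H]; split=> // /H[[dl [Sdl ub Sa fol]]|]; try by right.
  by left; exists dl; split=> //; apply: follows_ext fol.
by left; exists dl; split=> //; apply: follows_ext fol => x xa; rewrite tt'.
Qed.

Lemma levels_exist : well_ordered L ->
  exists T : L -> set (set L), forall a, T a = next_level a T.
Proof.
move=> hwo; have [T TE] := wf_rec hwo set0 next_level.
exists T => a; rewrite {1}TE; apply: next_level_ext => x xa.
by rewrite xa.
Qed.

Lemma restrI X a b : a <= b -> (X `&` below b) `&` below a = X `&` below a.
Proof.
move=> ab; rewrite -setIA; congr (_ `&` _); apply/seteqP; split=> x /=.
  by move=> [].
by move=> xa; split=> //; apply: lt_le_trans ab.
Qed.

Lemma restr_id X a b : X `<=` below a -> a <= b -> X `&` below b = X.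
Proof.
move=> Xa ab; apply/seteqP; split=> x; first by case.
by move=> Xx; split=> //; apply: lt_le_trans (Xa _ Xx) ab.
Qed.

Lemma nle_trans n m k : nle n m -> nle m k -> nle n k.
Proof.
move=> [nm E] [mk E']; split; first exact: le_trans mk.
by rewrite -(restrI _ nm) E'.
Qed.

Lemma nle_common n m k : nle n k -> nle m k -> n.1 <= m.1 -> nle n m.
Proof. by move=> [_ E] [_ E'] nm; split=> //; rewrite -E' restrI. Qed.

Lemma nle_restr b n : b <= n.1 -> nle (b, n.2 `&` below b) n.
Proof. by []. Qed.

End Construction.

(** * Bounds of short chains, and chains meeting dense sets *)

Section Levels.
Context {d : Order.disp_t} {L : orderType d}.
Variables (mu : L) (Sstar : set L) (c : L -> set L) (P : L -> L -> set (set L)).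
Variable code : L * set L -> L.
Variable T : L -> set (set L).
Implicit Types (a b q k dl xi : L) (n m : L * set L) (X Y Z A : set L).
Hypothesis hwo : well_ordered L.
Hypothesis hmu : infinite_cardinal mu.
Hypothesis hlambda : is_successor_cardinal mu.
Hypothesis ha2 : [set: short_sequences mu] #= below mu.
Hypothesis TE : forall a, T a = next_level mu Sstar c P code a T.

Let tb := tbelow T.

Lemma T_branch a X : T a X -> branches (tb a) a X.
Proof. by rewrite TE => -[]. Qed.

Lemma T_sub a X : T a X -> X `<=` below a.
Proof. by move=> /T_branch[]. Qed.

Lemma T_id a X : T a X -> X `&` below a = X.
Proof. by move=> /T_sub Xa; apply: restr_id Xa (lexx a). Qed.

Lemma T_restr a b X : T a X -> b <= a -> T b (X `&` below b).
Proof.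
move=> TX; rewrite le_eqVlt => /orP[/eqP->|ba].
  by rewrite T_id.
by have [_ /(_ b ba)[]] := T_branch TX.
Qed.

Lemma T_cf a X : cf a <> mu -> branches (tb a) a X -> T a X.
Proof. by move=> cfa bX; rewrite TE; split. Qed.

Lemma nle_refl n : T n.1 n.2 -> nle n n.
Proof. by move=> Tn; split=> //; apply: T_id. Qed.

Lemma nle_eq n m : T m.1 m.2 -> nle n m -> m.1 <= n.1 -> n = m.
Proof.
move=> Tm [nm E] mn; case: n m nm mn E Tm => [a X] [b Y] /= ab ba E TY.
have ? : a = b by apply/le_anti; rewrite ab.
by subst b; rewrite -E (T_id TY).
Qed.

(** The union of the chain works; when its height is attained, the union is the top node itself and
    hence already in the level. *)
Lemma chain_branch (C : set (L * set L)) s :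
  (forall n, C n -> T n.1 n.2) ->
  (forall n m, C n -> C m -> n.1 <= m.1 -> nle n m) ->
  supremums [set n.1 | n in C] s ->
  exists U, [/\ branches (tb s) s U, forall n, C n -> nle n (s, U) &
                (exists2 n, C n & n.1 = s) -> T s U].
Proof.
move=> CT Cch sups.
pose U := [set x | exists2 n, C n & n.2 x].
have UC n : C n -> nle n (s, U).
  move=> Cn; split; first by apply: (sup_ge sups); exists n.
  apply/seteqP; split=> x.
    move=> [[m Cm mx] xn]; case: (leP m.1 n.1) => [mn|/ltW nm].
      have [_ E] := Cch _ _ Cm Cn mn; by move: mx; rewrite -E => -[].
    by have [_ <-] := Cch _ _ Cn Cm nm; split.
  by move=> nx; split; [exists n|apply: T_sub (CT _ Cn) _ nx].
have Us : U `<=` below s.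
  move=> x [n Cn nx]; apply: lt_le_trans (T_sub (CT _ Cn) nx) _.
  by apply: (sup_ge sups); exists n.
exists U; split=> //.
  split=> // b bs; split=> //=.
  have [_ [n Cn <-] bn] := sup_lt sups bs.
  have [_ E] := UC n Cn; rewrite -(restrI _ (ltW bn)) E.
  exact: T_restr (CT _ Cn) (ltW bn).
move=> [n Cn nE]; have [_ /=] := UC n Cn.
by rewrite nE (restr_id Us (lexx _)) => ->; rewrite -nE; apply: CT.
Qed.

(** If the supremum of the heights is not attained, its cofinality is at most [k < mu], so the union
    of the chain is a node. The last two clauses serve to show that the bound stays below a level of
    cofinality greater than [k]. *)
Lemma short_chain k (N : L -> L * set L) n0 : k < mu -> T n0.1 n0.2 ->
  (forall j, j < k -> T (N j).1 (N j).2 /\ nle n0 (N j)) ->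
  (forall i j, i < j -> j < k -> nle (N i) (N j)) ->
  exists n, [/\ T n.1 n.2, nle n0 n, forall j, j < k -> nle (N j) n,
    [\/ n.1 = n0.1, exists2 j, j < k & n.1 = (N j).1 | cf n.1 <= k] &
    forall b, n0.1 <= b -> (forall j, j < k -> (N j).1 <= b) -> n.1 <= b].
Proof.
move=> km Tn0 TN Nch.
(* Including [n0] keeps the chain nonempty when [k] is the least ordinal. *)
pose C := [set n | n = n0 \/ exists2 j, j < k & n = N j].
have [b0 b0P] := small_bounded hmu hlambda ha2 (fun j => (N j).1)
  (small_below hlambda k).
have [s sups] : exists s, supremums [set n.1 | n in C] s.
  apply: (wo_sup hwo (b := Order.max b0 n0.1)) => _ [n [->|[j jk ->]] <-].
    by rewrite le_max lexx orbT.
  by rewrite le_max (ltW (b0P j jk)).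
have CT n : C n -> T n.1 n.2 by move=> [->//|[j jk ->]]; apply: (TN j jk).1.
have Cch n m : C n -> C m -> n.1 <= m.1 -> nle n m.
  move=> [->|[i ik ->]] [->|[j jk ->]] nm.
  - exact: nle_refl.
  - exact: (TN j jk).2.
  - by rewrite -(nle_eq (TN i ik).1 (TN i ik).2 nm); apply: nle_refl.
  case: (ltgtP i j) => [ij|ji|<-]; first exact: Nch.
    by rewrite -(nle_eq (TN i ik).1 (Nch _ _ ji ik) nm); apply: nle_refl (TN j jk).1.
  exact: nle_refl (TN i ik).1.
have [U [bU CU TU]] := chain_branch CT Cch sups.
have C0 : C n0 by left.
have CN j : j < k -> C (N j) by right; exists j.
exists (s, U); rewrite /=.
have cases : [\/ s = n0.1, exists2 j, j < k & s = (N j).1 | cf s <= k /\ T s U].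
  have [[n [->|[j jk ->]] <-]|NA] := pselect (exists2 n, C n & n.1 = s).
  - by apply: Or31.
  - by apply: Or32; exists j.
  apply: Or33.
  have cfs : cf s <= k.
    apply: (cf_le hwo); exists (fun j => (N j).1); split=> [j jk|b bs].
      have := sup_ge sups (ex_intro2 _ _ _ (CN j jk) erefl).
      rewrite le_eqVlt => /orP[/eqP E|//].
      by case: NA; exists (N j) => //; apply: CN.
    have [_ [n [->|[j jk ->]] <-] bn] := sup_lt sups bs; last first.
      by exists j => //; apply: ltW.
    have n0s : n0.1 < s.
      have := sup_ge sups (ex_intro2 _ _ _ C0 erefl).
      rewrite le_eqVlt => /orP[/eqP E|//].
      by case: NA; exists n0.
    have [_ [n' [->|[j jk ->]] <-] bn'] := sup_lt sups n0s.
      by rewrite ltxx in bn'.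
    by exists j => //; apply/ltW/(lt_trans bn).
  split=> //; apply: T_cf => // E; by move: cfs; rewrite E leNgt km.
split.
- case: cases => [E|[j jk E]|[] //]; apply: TU.
    by exists n0.
  by exists (N j) => //; apply: CN.
- exact: CU.
- by move=> j /CN/CU.
- by case: cases => [E|E|[E _]]; [apply: Or31|apply: Or32|apply: Or33].
move=> b nb Nb; apply: (sup_le sups) => _ [n [->|[j jk ->]] <-] //.
exact: Nb.
Qed.

Definition extendible a : Prop :=
  forall n, tb a n -> exists2 Z, T a Z & nle n (a, Z).

Lemma dense_setT a : dense code (tb a) setT.
Proof. by move=> n [na Tn]; exists n; split=> //; apply: nle_refl. Qed.

(** Stage [i] bounds the earlier nodes by [short_chain], climbs to height [th i], then enters the
    dense set [q i]; the bound stays below [a] because [i < cf a]. *)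
Lemma build a k n0 (q : L -> set L) (th : L -> L) :
  (forall b, b < a -> extendible b) -> k <= cf a -> tb a n0 ->
  (forall i, i < k -> dense code (tb a) (q i)) -> (forall i, i < k -> th i < a) ->
  exists N : L -> L * set L, forall i, i < k ->
    [/\ tb a (N i), nle n0 (N i), forall j, j < i -> nle (N j) (N i),
        th i <= (N i).1 & q i (code (N i))].
Proof.
move=> ext kcf [n0a Tn0] qd tha.
pose R i (f : L -> L * set L) u := [/\ tb a u, nle n0 u,
  forall j, j < i -> nle (f j) u, th i <= u.1 & q i (code u)].
apply: (wf_choice hwo n0 (R := R)).
  move=> i f g fg u [? ? H ? ?]; split=> // j ji; rewrite -fg //; exact: H.
move=> i f ik IH.
have im : i < mu.
  by apply: (lt_le_trans ik); apply: (le_trans kcf); apply: cf_le_mu.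
have [n1 [Tn1 n01 fn1 cs lub]] := short_chain (N := f) im Tn0
  (fun j ji => let: And5 H1 H2 _ _ _ := IH j ji in conj H1.2 H2)
  (fun j l jl li => let: And5 _ _ H _ _ := IH l li in H j jl).
have fa j : j < i -> (f j).1 < a by move=> /IH[[]].
have n1a : n1.1 < a.
  case: cs => [->//|[j ji ->]|cfn]; first exact: fa.
  have : n1.1 <= a by apply: lub => [|j ji]; apply: ltW => //; apply: fa.
  rewrite le_eqVlt => /orP[/eqP E|//].
  by move: (lt_le_trans ik kcf); rewrite ltNge -E cfn.
have [n2 [tn2 n12 thn2]] : exists n2, [/\ tb a n2, nle n1 n2 & th i <= n2.1].
  case: (leP (th i) n1.1) => [le|lt].
    by exists n1; split=> //; apply: nle_refl.
  have [Z TZ nZ] := ext (th i) (tha i ik) n1 (conj lt Tn1).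
  by exists (th i, Z); split=> //; split=> //=; apply: tha.
have [n3 [tn3 n23 qn3]] := qd i ik n2 tn2.
exists n3; split=> //.
- exact: nle_trans n01 (nle_trans n12 n23).
- move=> j ji; exact: nle_trans (fn1 j ji) (nle_trans n12 n23).
- exact: le_trans n23.1.
Qed.

(* At the indices that enumerate nothing the value is setT, which is dense. *)
Definition enum_dense a (Q : set (set L)) (f : set L -> L) i : set L :=
  xget setT [set A | [/\ Q A, dense code (tb a) A & f A = i]].

Lemma enum_dense_dense a Q f i : dense code (tb a) (enum_dense a Q f i).
Proof. by rewrite /enum_dense; case: xgetP => [A _ []//|_]; apply: dense_setT. Qed.

Lemma enum_dense_id a Q f A : Q A -> dense code (tb a) A ->
  (forall A B, Q A -> Q B -> f A = f B -> A = B) -> enum_dense a Q f (f A) = A.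
Proof.
move=> QA dA finj; apply: xget_unique => // B [QB _]; exact: finj.
Qed.

(** A cofinal map supplies the heights that make the chain reach up to [a], while its [cf a] stages
    serve every set in [Q]. *)
Lemma meet_branch a n0 (Q : set (set L)) : limit_ordinal a ->
  (forall b, b < a -> extendible b) -> tb a n0 -> Q #<= below (cf a) ->
  exists Z, [/\ branches (tb a) a Z, nle n0 (a, Z) &
    forall A, Q A -> dense code (tb a) A -> hits code A a Z].
Proof.
move=> [[b0 b0a] lima] ext tn0 /(card_le_exP _ _ (inhabits mu))[f [fcf finj]].
have [th [tha thcof]] := (cf_cofinal hwo a).1.
have [N NP] := build ext (lexx _) tn0
  (fun i _ => @enum_dense_dense a Q f i) tha.
pose C := [set n | exists2 i, i < cf a & n = N i].
have sups : supremums [set n.1 | n in C] a.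
  split=> [_ [n [i /NP[[Na _] _ _ _ _] ->] <-]|y yub]; first exact: ltW.
  rewrite leNgt; apply/negP => /lima[z yz /thcof[i ik zi]].
  have [_ _ _ thN _] := NP i ik.
  have : (N i).1 <= y by apply: yub; exists (N i) => //; exists i.
  by rewrite leNgt (lt_le_trans yz (le_trans zi thN)).
have [||U [bU CU _]] := chain_branch (C := C) _ _ sups.
- by move=> n [i /NP[[]] ? ? _ _ _ _ ->].
- move=> _ _ [i ik ->] [j jk ->].
  have [[_ Ti] _ Hi _ _] := NP i ik; have [[_ Tj] _ Hj _ _] := NP j jk.
  case: (ltgtP i j) => [/Hj//|/Hi ji le|<- _]; last exact: nle_refl.
  by rewrite -(nle_eq Ti ji le); apply: nle_refl.
exists U; split=> //.
  have [i ik _] := thcof _ b0a; have [_ n0N _ _ _] := NP i ik.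
  by apply: nle_trans n0N _; apply: CU; exists i.
move=> A QA dA; have [[Na TN] _ _ _] := NP _ (fcf _ QA).
rewrite enum_dense_id // => AN; exists (N (f A)).1 => //.
have [|_ /= ->] := CU (N (f A)); last by case: (N (f A)) AN.
by exists (f A) => //; apply: fcf.
Qed.

(** With fewer than [cf a] dense sets the chain is bounded strictly below [a], so any extension of
    the bound to level [a] meets them all. This serves the levels in [Sstar], where (c) gives fewer
    than mu sets. *)
Lemma meet_bounded a n0 (Q : set (set L)) k (f : set L -> L) :
  (forall b, b < a -> extendible b) -> tb a n0 -> k < cf a ->
  (forall A, Q A -> f A < k) ->
  (forall A B, Q A -> Q B -> f A = f B -> A = B) ->
  exists n, [/\ tb a n, nle n0 n &
    forall A, Q A -> dense code (tb a) A ->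
      exists2 b, b <= n.1 & A (code (b, n.2 `&` below b))].
Proof.
move=> ext [n0a Tn0] kcf fk finj.
have [N NP] := build (th := fun=> n0.1) ext (ltW kcf) (conj n0a Tn0)
  (fun i _ => @enum_dense_dense a Q f i) (fun _ _ => n0a).
have km : k < mu by apply: (lt_le_trans kcf); apply: cf_le_mu.
have [n1 [Tn1 n01 fn1 cs lub]] := short_chain (N := N) km Tn0
  (fun j ji => let: And5 H1 H2 _ _ _ := NP j ji in conj H1.2 H2)
  (fun j l jl li => let: And5 _ _ H _ _ := NP l li in H j jl).
have fa j : j < k -> (N j).1 < a by move=> /NP[[]].
exists n1; split=> //.
  split=> //; case: cs => [->//|[j ji ->]|cfn]; first exact: fa.
  have : n1.1 <= a by apply: lub => [|j ji]; apply: ltW => //; apply: fa.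
  rewrite le_eqVlt => /orP[/eqP E|//].
  by move: kcf; rewrite ltNge -E cfn.
move=> A QA dA; have [[Na TN] _ _ _] := NP _ (fk _ QA).
rewrite enum_dense_id // => AN; exists (N (f A)).1.
  exact: (fn1 _ (fk _ QA)).1.
by have [_ ->] := fn1 _ (fk _ QA); case: (N (f A)) AN.
Qed.

(** * Branches following a [c_delta], and extension of nodes to all higher levels *)

Hypothesis hb1 : forall delta : L, Sstar delta -> cf delta = mu.
Hypothesis hb2 : forall delta : L, Sstar delta ->
     [/\ c delta `<=` below delta,
         supremums (c delta) delta,
         closed_in (c delta) delta
       & forall a : L, c delta a -> limit_ordinal a].
Hypothesis hc : forall delta a : L, Sstar delta -> nacc (c delta) a ->
     [/\ forall X : set L, P delta a X -> X `<=` below a,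
         P delta a #<= below (cf a)
       & Sstar a -> card_lt (P delta a) (below mu)].
Hypothesis he : forall delta deltastar : L, Sstar delta -> Sstar deltastar ->
     acc (c deltastar) delta ->
     exists2 a : L, a < delta &
       nacc (c delta) `&` [set b | a < b < delta]
         = nacc (c deltastar) `&` [set b | a < b < delta] /\
       forall b : L, nacc (c delta) b -> a < b < delta ->
         P delta b = P deltastar b.

(** Otherwise [b], being a limit ordinal, would be an accumulation point of [c dl]. *)
Lemma nacc_sup_lt dl b q : Sstar dl -> nacc (c dl) b ->
  supremums (nacc (c dl) `&` below b) q -> q < b.
Proof.
move=> Sdl [cb nab] sq; rewrite lt_neqAle; apply/andP; split; last first.
  by apply: (sup_le sq) => x [_ /ltW].
apply/eqP => qb; subst q; apply: nab; have [_ _ _ lim] := hb2 Sdl.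
split; first by have [] := lim b cb.
split=> [x [_ /ltW]//|y yub]; apply: (sup_le sq) => x [[cx _] xb].
by apply: yub.
Qed.

(** The least element of [c dl] above [b] is not an accumulation point. *)
Lemma nacc_unbounded dl : Sstar dl -> unbounded_in (nacc (c dl)) dl.
Proof.
move=> Sdl b bdl; have [cdl sc _ _] := hb2 Sdl.
have [x cx bx] := sup_lt sc bdl.
have [m [cm bm] minm] := wo_min hwo (A := [set x | c dl x /\ b < x]) (conj cx bx).
exists m; last by rewrite bm; apply: cdl.
split=> // -[_ sm]; have [y [cy ym] yb] := sup_lt sm bm.
by have := minm y (conj cy yb); rewrite leNgt ym.
Qed.

Lemma nacc_sup dl b : exists q, supremums (nacc (c dl) `&` below b) q.
Proof. by apply: (wo_sup hwo (b := b)) => x [_ /ltW]. Qed.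

(* Coherence (e): a branch that follows c_dl up to a follows c_a eventually. *)
Lemma follows_T dl a X : Sstar dl -> unbounded_in (nacc (c dl)) a ->
  branches (tb a) a X -> follows c P code T dl a X -> T a X.
Proof.
move=> Sdl ub bX fol; rewrite TE; split=> // cfa; left.
have [Sa|NSa] := pselect (Sstar a); last by exists dl; split.
(* Unboundedness makes [a] an accumulation point of [c dl], so (e) applies. *)
have [|e ea [Eacc EP]] := he Sa Sdl.
  split; first by have [] := cf_mu_limit hwo hmu cfa.
  split=> [x [_ /ltW]//|y yub]; rewrite leNgt; apply/negP => /ub[g [cg _]].
  by move=> /andP[yg ga]; have := yub g (conj cg ga); rewrite leNgt yg.
have Eab g : e < g < a -> nacc (c a) g <-> nacc (c dl) g.
  move=> eg; split=> ng.
    by have : (nacc (c a) `&` [set b | e < b < a]) g by []; rewrite Eacc => -[].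
  by have : (nacc (c dl) `&` [set b | e < b < a]) g by []; rewrite -Eacc => -[].
exists a; split=> //; first exact: nacc_unbounded.
have [xi xia fX] := fol.
(* From a point of [nacc (c a)] above both [e] and [xi] on, [c a] and [c dl] have the same
   non-accumulation points below [a], hence the same previous levels [q]. *)
have [] := @nacc_unbounded a Sa (Order.max e xi); first by rewrite gt_max ea.
move=> xi' nxi'; rewrite gt_max => /andP[/andP[exi' xixi'] xi'a].
exists xi' => // b q nb ba sq xi'q.
have qb := nacc_sup_lt Sa nb sq.
have eb : e < b < a by rewrite ba andbT (lt_trans exi') // (le_lt_trans xi'q).
have nxi'dl : nacc (c dl) xi' by apply/Eab => //; rewrite exi'.
have sq' : supremums (nacc (c dl) `&` below b) q.
  split=> [g [ng gb]|y yub].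
    have [gx|xg] := leP g xi'; first exact: le_trans xi'q.
    apply: (sup_ge sq); split=> //; apply/Eab => //.
    by rewrite (lt_trans exi' xg) (lt_trans gb ba).
  apply: (sup_le sq) => g [ng gb]; have [gx|xg] := leP g xi'.
    apply: (le_trans gx); apply: yub; split=> //.
    exact: le_lt_trans xi'q qb.
  apply: yub; split=> //; apply/Eab => //.
  by rewrite (lt_trans exi' xg) (lt_trans gb ba).
rewrite EP //; apply: fX => //; first by apply/Eab.
exact: le_trans (ltW xixi') xi'q.
Qed.

(** A version of [follows] for nodes: the starting point is fixed, and level [a] itself is governed
    too. *)
Definition follows_upto dl xi a X : Prop := forall b q, nacc (c dl) b -> b <= a ->
  supremums (nacc (c dl) `&` below b) q -> xi <= q ->
  X `&` below b = choose_hit code (tb b) (T b) b (q, X `&` below q) (P dl b).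

(** By induction the earlier restrictions agree, hence also those to the previous level [q], from
    which [choose_hit] makes the same choice. *)
Lemma follows_unique dl dl' xi b X Y : nacc (c dl) xi ->
  (forall g, g <= b -> nacc (c dl) g <-> nacc (c dl') g) ->
  (forall g, g <= b -> nacc (c dl) g -> P dl g = P dl' g) ->
  follows_upto dl xi b X -> follows_upto dl' xi b Y ->
  X `&` below xi = Y `&` below xi -> xi <= b -> nacc (c dl) b ->
  X `&` below b = Y `&` below b.
Proof.
move=> nxi En EP fX fY E.
elim/(well_founded_ind hwo): b En EP fX fY => b IH En EP fX fY.
rewrite le_eqVlt => /orP[/eqP<-//|xib] nb.
have [q sq] := nacc_sup dl b.
have xiq : xi <= q by apply: (sup_ge sq).
have sq' : supremums (nacc (c dl') `&` below b) q.
  congr (supremums _ q): sq; apply/seteqP; split=> g [ng gb]; split=> //.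
    by apply/En => //; apply: ltW.
  by apply/En => //; apply: ltW.
rewrite (fX b q) // (fY b q) //; last by apply/En.
rewrite EP //; suff -> : X `&` below q = Y `&` below q by [].
have H g : nacc (c dl) g -> g < b -> X `&` below g = Y `&` below g.
  move=> ng gb; have [gx|xg] := leP g xi.
    by rewrite -(restrI X gx) -(restrI Y gx) E.
  apply: IH => //; try exact: ltW.
  - by move=> h hg; apply: En; apply: le_trans (ltW gb).
  - by move=> h hg; apply: EP; apply: le_trans (ltW gb).
  - by move=> h r nh hg; apply: fX => //; apply: le_trans (ltW gb).
  - by move=> h r nh hg; apply: fY => //; apply: le_trans (ltW gb).
apply/seteqP; split=> x [Xx xq]; have [g [ng gb] xg] := sup_lt sq xq; split=> //.
  have : (X `&` below g) x by []; by rewrite H // => -[].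
have : (Y `&` below g) x by []; by rewrite -H // => -[].
Qed.

(** This guarantees that [choose_hit] at [a] returns a node of the level rather than its default. *)
Definition hittable a : Prop := forall dl n, Sstar dl -> nacc (c dl) a -> tb a n ->
  exists Z, [/\ T a Z, nle n (a, Z) &
    forall A, P dl a A -> dense code (tb a) A -> hits code A a Z].

Lemma choose_hit_spec dl a n : hittable a -> Sstar dl -> nacc (c dl) a -> tb a n ->
  let Z := choose_hit code (tb a) (T a) a n (P dl a) in
  [/\ T a Z, nle n (a, Z) &
    forall A, P dl a A -> dense code (tb a) A -> hits code A a Z].
Proof.
move=> h Sdl na tn Z; have [Z' Z'P] := h dl n Sdl na tn.
exact: (@xgetI _ set0 [set Z | [/\ T a Z, nle n (a, Z) &
  forall A, P dl a A -> dense code (tb a) A -> hits code A a Z]] Z').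
Qed.

Section Following.
Variables (dl xi : L) (Z0 : set L).
Hypothesis Sdl : Sstar dl.
Hypothesis nxi : nacc (c dl) xi.
Hypothesis TZ0 : T xi Z0.

Let foll n : Prop :=
  [/\ T n.1 n.2, nle (xi, Z0) n & follows_upto dl xi n.1 n.2].

(** By [follows_unique] the nodes at points of [nacc (c dl)] form a chain. Its union is a node,
    either because [q] is attained or because the union follows [c dl] up to [q] and [follows_T]
    applies. *)
Lemma following_limit b q : xi < b ->
  (forall g, nacc (c dl) g -> xi <= g -> g < b -> exists X, foll (g, X)) ->
  supremums (nacc (c dl) `&` below b) q ->
  exists U, T q U /\ forall n, nacc (c dl) n.1 -> n.1 < b -> foll n -> nle n (q, U).
Proof.
move=> xib ex sq.
pose C := [set n | [/\ nacc (c dl) n.1, n.1 < b & foll n]].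
have Cxi g : nacc (c dl) g -> g < b -> xi <= g -> exists2 n, C n & n.1 = g.
  by move=> ng gb xig; have [X fX] := ex g ng xig gb; exists (g, X).
have sups : supremums [set n.1 | n in C] q.
  split=> [_ [n [ng gb _] <-]|y yub]; first exact: (sup_ge sq).
  apply: (sup_le sq) => g [ng gb]; have [gx|xg] := leP g xi.
    have [n Cn nE] := Cxi xi nxi xib (lexx _); rewrite -nE in gx.
    by apply: (le_trans gx); apply: yub; exists n.
  by have [n Cn nE] := Cxi g ng gb (ltW xg); apply: yub; exists n.
have [||U [bU CU TU]] := chain_branch _ _ sups.
- by move=> n [_ _ []].
- move=> n m [nn nb [Tn xn fn]] [nm mb [Tm xm fm]] le; split=> //.
  rewrite -[RHS](T_id Tn); apply: (follows_unique nxi (dl' := dl)) => //.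
  + by move=> h r nh hg; apply: fm => //; apply: le_trans le.
  + by have [_ ->] := xm; have [_ ->] := xn.
  + by have [] := xn.
exists U; split; last by move=> n nn nb fn; apply: CU.
have [|NA] := pselect (exists2 n, C n & n.1 = q); first exact: TU.
have xiq : xi <= q by apply: (sup_ge sq).
have ltq g : nacc (c dl) g -> xi <= g -> g < b -> g < q.
  move=> ng xig gb; rewrite lt_neqAle (sup_ge sq) // andbT; apply/eqP => E.
  by apply: NA; have [n Cn nE] := Cxi g ng gb xig; exists n => //; rewrite nE.
apply: (follows_T Sdl) => //.
  move=> x xq; have [g [ng gb] xg] := sup_lt sq xq.
  have [gx|/ltW gx] := leP g xi; last by exists g => //; rewrite xg ltq.
  by exists xi => //; rewrite (lt_le_trans xg gx) ltq.
exists xi; first exact: ltq.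
move=> g r ng gq sr xir.
have rg := nacc_sup_lt Sdl ng sr.
have gb : g < b by apply: lt_le_trans gq _; apply: (sup_le sq) => x [_ /ltW].
have [n Cn nE] := Cxi g ng gb (ltW (le_lt_trans xir rg)).
have [_ /= E] := CU n Cn; have [_ _ [_ _ fn]] := Cn.
rewrite -(restrI U (ltW rg)) -nE E nE -(fn g r) ?nE //.
by rewrite -nE -E restrI.
Qed.

(** [following_limit] gives the node at the previous level [q], and [choose_hit] carries it to
    [b]. *)
Lemma following b : (forall g, g < b -> hittable g) -> hittable b ->
  nacc (c dl) b -> xi <= b -> exists X, foll (b, X).
Proof.
elim/(well_founded_ind hwo): b => b IH hit hitb nb.
rewrite le_eqVlt => /orP[/eqP<-|xib].
  exists Z0; split=> //; first exact: nle_refl.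
  (* At the starting point the condition is vacuous, since [q < g <= xi]. *)
  move=> g q ng gxi sq xiq; have := nacc_sup_lt Sdl ng sq.
  by rewrite ltNge (le_trans gxi).
have [q sq] := nacc_sup dl b.
have [|U [TU UP]] := following_limit xib _ sq.
  move=> g ng xig gb; apply: IH => //; last exact: hit.
  by move=> h hg; apply: hit; apply: lt_trans gb.
have qb := nacc_sup_lt Sdl nb sq.
have [/= TX [_ /= qX] _] := choose_hit_spec (n := (q, U)) hitb Sdl nb (conj qb TU).
set X := choose_hit _ _ _ _ _ _ in TX qX; exists X.
have fxi : foll (xi, Z0).
  split=> //; first exact: nle_refl.
  move=> g r ng gxi sr xir; have := nacc_sup_lt Sdl ng sr.
  by rewrite ltNge (le_trans gxi).
split=> //.
  by apply: (@nle_trans _ _ _ (q, U)); [exact: UP|split=> //=; apply: ltW].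
move=> g r ng; rewrite le_eqVlt => /orP[/eqP gE|gb] sr xir.
  subst g; rewrite (sup_unique sr sq) /= in xir *.
  by rewrite (T_id TX) qX.
have rg := nacc_sup_lt Sdl ng sr.
have xig : xi <= g by apply: ltW (le_lt_trans xir rg).
have [Y fY] : exists Y, foll (g, Y).
  apply: IH => //; last exact: hit.
  by move=> h hg; apply: hit; apply: lt_trans gb.
have [/= gq /= E] := UP (g, Y) ng gb fY; have [_ _ /= fYg] := fY.
have XY : X `&` below g = Y by rewrite -E -qX restrI.
by rewrite XY -(restrI X (ltW rg)) XY -(fYg g r) // -XY restrI.
Qed.

End Following.

(** Raise the node to a level in [nacc (c a)] and follow [c a] from there: for [b = a] the supremum
    in [following_limit] is [a] itself. *)
Lemma extendible_S a : Sstar a -> (forall b, b < a -> extendible b /\ hittable b) ->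
  extendible a.
Proof.
move=> Sa IH n [na Tn].
have [xi nxi /andP[nx xia]] := nacc_unbounded Sa na.
have [Z0 TZ0 nZ0] := (IH xi xia).1 n (conj nx Tn).
have sa : supremums (nacc (c a) `&` below a) a.
  split=> [x [_ /ltW//]|y yub]; rewrite leNgt; apply/negP => ya.
  have [g ng /andP[yg ga]] := nacc_unbounded Sa ya.
  by have := yub g (conj ng ga); rewrite leNgt yg.
have [|U [TU UP]] := following_limit (Z0 := Z0) Sa nxi xia _ sa.
  move=> g ng xig ga; apply: following => //; last exact: (IH g ga).2.
  by move=> h hg; apply: (IH h (lt_trans hg ga)).2.
exists U => //; apply: nle_trans nZ0 _; apply: UP => //; split=> //.
  exact: nle_refl.
move=> g r ng gxi sr xir; have := nacc_sup_lt Sa ng sr.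
by rewrite ltNge (le_trans gxi).
Qed.

(** One induction proves both properties, since following [c a] at a level in [Sstar] uses both of
    them below [a]. *)
Lemma extension a : extendible a /\ hittable a.
Proof.
elim/(well_founded_ind hwo): a => a IH.
have ext b : b < a -> extendible b by move=> /IH[].
have lim dl : Sstar dl -> nacc (c dl) a -> limit_ordinal a.
  by move=> /hb2[_ _ _ H] [/H].
have [cfa|cfa] := pselect (cf a = mu); last first.
  have hita : hittable a.
    move=> dl n Sdl na tn; have [_ Pcf _] := hc Sdl na.
    have [Z [bZ nZ ZP]] := meet_branch (lim dl Sdl na) ext tn Pcf.
    by exists Z; split=> //; apply: T_cf.
  split=> // n tn; have [lima|nlim] := pselect (limit_ordinal a).
    have [Z [bZ nZ _]] := meet_branch lima ext tn (card_ge0 _ _).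
    by exists Z => //; apply: T_cf.
  have [na Tn] := tn.
  (* Now [a] is the successor of [b], and the subset [Z] of [b] is reused as a node of height
     [a]. *)
  have [b ba maxb] : exists2 b, b < a & forall x, x < a -> x <= b.
    apply: contrapT => H; apply: nlim; split; first by exists n.1.
    move=> b ba; apply: contrapT => H'; apply: H; exists b => // x xa.
    by rewrite leNgt; apply/negP => bx; apply: H'; exists x.
  have [Z TZ nZ] : exists2 Z, T b Z & nle n (b, Z).
    have := maxb _ na; rewrite le_eqVlt => /orP[/eqP <-|nb]; last exact: (ext b ba).
    by exists n.2 => //; have := nle_refl Tn; case: (n).
  exists Z; last by split; [apply: ltW|case: nZ].
  apply: T_cf => //; split.
    by move=> x /(T_sub TZ) xb; apply: lt_trans ba.
  by move=> x xa; split=> //=; apply: T_restr TZ (maxb _ xa).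
have lima := cf_mu_limit hwo hmu cfa.
have [Sa|NSa] := pselect (Sstar a).
  have exta := extendible_S Sa IH; split=> // dl n Sdl na tn.
  have [_ _ /(_ Sa)/(small_enum hwo hmu)[k [f [km fk finj]]]] := hc Sdl na.
  rewrite -cfa in km.
  have [m [tm nm mP]] := meet_bounded ext tn km fk finj.
  have [Z TZ mZ] := exta m tm; exists Z; split=> //.
    exact: nle_trans nm mZ.
  move=> A PA dA; have [b bm Ab] := mP A PA dA.
  exists b; first exact: le_lt_trans tm.1.
  by have [_ /= E] := mZ; rewrite -(restrI Z bm) E.
(* Outside [Sstar], [meet_branch] shows that the choice in the last clause of [next_level] succeeds,
   and that clause puts the chosen branch into level [a]. *)
have key Q n : families Sstar c P a Q -> Q #<= below (cf a) -> tb a n ->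
    exists Z, [/\ T a Z, nle n (a, Z) &
      forall A, Q A -> dense code (tb a) A -> hits code A a Z].
  move=> FQ Qcf tn; have [Z ZP] := meet_branch lima ext tn Qcf.
  have [bp np hp] := @xgetI _ set0 [set Z | [/\ branches (tb a) a Z, nle n (a, Z) &
    forall A, Q A -> dense code (tb a) A -> hits code A a Z]] Z ZP.
  exists (choose_hit code (tb a) (branches (tb a) a) a n Q); split=> //.
  rewrite TE; split=> // _; right; split=> //.
  by exists n, Q.
split=> [n tn|dl n Sdl na tn].
  have [|Z [TZ nZ _]] := key set0 n _ (card_ge0 _ _) tn; first by left.
  by exists Z.
have [_ Pcf _] := hc Sdl na; apply: key => //; right; by exists dl.
Qed.

(** * Every level has at most mu nodes *)

Hypothesis hf : forall gamma : L,
     [set restr_seq c P delta gamma | delta in Sstar] #<= below mu.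

Lemma restr_seq_agree dl dl' g b : restr_seq c P dl g = restr_seq c P dl' g ->
  b < g -> nacc (c dl) b -> nacc (c dl') b /\ P dl b = P dl' b.
Proof.
move=> E bg nb; have : restr_seq c P dl g (b, P dl b) by exists b.
by rewrite E => -[b' [nb' _] [<- <-]].
Qed.

Lemma small_families a : small mu (families Sstar c P a).
Proof.
(* The restriction to [g] must contain the index [a] itself, so [g] is taken above [a]. *)
have [g ag] := no_max hmu hlambda ha2 a.
apply: (small_sub (B := [set set0] `|`
  [set Q | exists dl, [/\ Sstar dl, nacc (c dl) a & Q = P dl a]])).
  by move=> Q [->|[dl H]]; [left|right; exists dl].
apply: small_setU => //; first exact: small_set1.
apply: (small_rel (R := fun Q s => forall Q', s (a, Q') <-> Q' = Q)); last first.
- by apply/smallE; apply: (hf g).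
- by move=> Q Q' s _ _ H H'; apply/H'/H.
move=> Q [dl [Sdl na ->]]; exists (restr_seq c P dl g); first by exists dl.
by move=> Q'; split=> [[b _ [-> <-]]|->] //; exists a.
Qed.

(** By [follows_unique] such a branch is determined by the restricted sequence and by one node at a
    point from which it follows [c dl]; (f) leaves at most mu sequences. *)
Lemma small_follows a : small mu (tb a) -> small mu [set X | X `<=` below a /\
  exists dl, [/\ Sstar dl, unbounded_in (nacc (c dl)) a,
                 branches (tb a) a X & follows c P code T dl a X]].
Proof.
move=> stb.
pose R X (p : set (L * set (set L)) * (L * set L)) := exists dl,
  [/\ unbounded_in (nacc (c dl)) a, p.1 = restr_seq c P dl a,
      p.2.2 = X `&` below p.2.1, nacc (c dl) p.2.1 &
      p.2.1 < a /\ forall b, b < a -> follows_upto dl p.2.1 b X].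
have sB := small_setX hmu ha2 ((smallE _ _).1 (hf a)) stb.
apply: (small_rel (R := R)) sB.
  move=> X [Xa [dl [Sdl ub bX [xi xia fol]]]].
  have [xi' nxi' /andP[xx xa]] := ub _ xia.
  exists (restr_seq c P dl a, (xi', X `&` below xi')).
    by split=> /=; [exists dl|have [_ /(_ _ xa)] := bX].
  exists dl; split=> //; split=> // b ba g q ng gb sq xq.
  apply: fol => //; first exact: le_lt_trans ba.
  exact: le_trans (ltW xx) xq.
move=> X Y [s [xi Z]] [Xa _] [Ya _] [dl [/= ub -> EX nxi [xia fX]]].
move=> [dl' [/= ub' Es EY nxi' [_ fY]]].
have key b : nacc (c dl) b -> xi <= b -> b < a -> X `&` below b = Y `&` below b.
  move=> nb xib ba; apply: (follows_unique nxi (dl' := dl')) => //.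
  - move=> g gb; have ga := le_lt_trans gb ba.
    split=> ng; first by have [] := restr_seq_agree Es ga ng.
    by have [] := restr_seq_agree (esym Es) ga ng.
  - by move=> g gb ng; have [] := restr_seq_agree Es (le_lt_trans gb ba) ng.
  - exact: fX.
  - exact: fY.
  - by rewrite -EX -EY.
have ex x : x < a -> exists g, [/\ nacc (c dl) g, xi <= g, g < a & x < g].
  move=> xa; have [] := ub (Order.max x xi); first by rewrite gt_max xa.
  move=> g ng; rewrite gt_max => /andP[/andP[xg xig] ga].
  by exists g; split=> //; apply: ltW.
apply/seteqP; split=> x Xx.
  have [g [ng xig ga xg]] := ex x (Xa _ Xx).
  have : (X `&` below g) x by []; by rewrite key // => -[].
have [g [ng xig ga xg]] := ex x (Ya _ Xx).
have : (Y `&` below g) x by []; by rewrite -key // => -[].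
Qed.

(** A branch is recovered from its values along a cofinal sequence of length less than mu, so
    mu^{<mu} = mu bounds their number. *)
Lemma small_branches a : cf a < mu -> small mu (tb a) ->
  small mu (branches (tb a) a).
Proof.
move=> cfa stb; have [f [fa fcof]] := (cf_cofinal hwo a).1.
have [e [em einj]] := code_fun ha2 cfa.
have [g [gm ginj]] := small_setX hmu ha2 stb (small_Prop hmu).
(* The truth value of [X (f i)] is recorded because a cofinal map only gives [b <= f i]; it matters
   when [a] is a successor. *)
pose h X i := g ((f i, X `&` below (f i)), X (f i)).
have tbX X i : branches (tb a) a X -> i < cf a ->
    (tb a `*` setT) ((f i, X `&` below (f i)), X (f i)).
  by move=> [_ bX] ik; split=> //=; apply: bX; apply: fa.
exists (e \o h); split=> [X bX|X Y bX bY /= E].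
  by apply: em => i ik; apply: gm; apply: tbX.
have {}E i : i < cf a -> X `&` below (f i) = Y `&` below (f i) /\ X (f i) = Y (f i).
  move=> ik; have : h X i = h Y i.
    by apply: einj E _ ik => j jk; apply: gm; apply: tbX.
  by move=> /(ginj _ _ (tbX _ _ bX ik) (tbX _ _ bY ik)) [-> ->].
apply/seteqP; split=> x Xx.
  have [i ik] := fcof x (bX.1 _ Xx).
  have [EX Ei] := E i ik; rewrite le_eqVlt => /orP[/eqP xE|xf].
    by rewrite xE -Ei -xE.
  have : (X `&` below (f i)) x by []; by rewrite EX => -[].
have [i ik] := fcof x (bY.1 _ Xx).
have [EX Ei] := E i ik; rewrite le_eqVlt => /orP[/eqP xE|xf].
  by rewrite xE Ei -xE.
have : (Y `&` below (f i)) x by []; by rewrite -EX => -[].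
Qed.

Lemma small_tbelow_of a : (forall b, b < a -> small mu (T b)) -> small mu (tb a).
Proof.
move=> IH; apply: (small_sub (B := \bigcup_(b in below a) (pair b @` T b))).
  by move=> [b X] [ba TX]; exists b => //; exists X.
apply: small_bigcup => //; first exact: small_below.
by move=> b ba; apply: small_image; apply: IH.
Qed.

Lemma small_level a : small mu (T a).
Proof.
elim/(well_founded_ind hwo): a => a /small_tbelow_of stb.
have := cf_le_mu hwo hlambda a; rewrite le_eqVlt => /orP[/eqP cfa|cfa]; last first.
  by apply: small_sub (small_branches cfa stb) => X /T_branch.
pose ch p := choose_hit code (tb a) (branches (tb a) a) a p.1 p.2.
apply: (small_sub (B := _ `|` ch @` (tb a `*` families Sstar c P a))); last first.
  apply: small_setU => //; first exact: small_follows stb.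
  by apply: small_image; apply: small_setX => //; apply: small_families.
move=> X TX; have := TX; rewrite TE => -[bX /(_ cfa)].
move=> [[dl [Sdl ub _ fol]]|[_ [n [Q [tn FQ XE]]]]].
  by left; split; [apply: T_sub|exists dl].
by right; exists (n, Q).
Qed.

Lemma small_tbelow a : small mu (tb a).
Proof. by apply: small_tbelow_of => b _; apply: small_level. Qed.

(** * Guessing dense sets, splitting, and the number of nodes *)

Hypothesis code_inj : forall n m, n.2 `<=` below n.1 -> m.2 `<=` below m.1 ->
  code n = code m -> n = m.
Hypothesis hd : forall A E : set L, club E ->
     exists S_AE : set L,
       [/\ stationary S_AE,
           S_AE `<=` Sstar
         & forall delta : L, S_AE delta ->
             supremums [set a | [/\ nacc (c delta) a,
                                    P delta a (A `&` below a)
                                  & E a]] delta].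

(** As [tb a] has at most mu nodes, [h] is bounded on it; iterating such bounds omega times gives a
    closure point, and the iterates are bounded because [mu] is infinite. *)
Lemma closure_club (h : L * set L -> L) :
  club [set a | forall n, tb a n -> h n < a].
Proof.
split=> [a|a [_ sa] n [na Tn]]; last first.
  have [b [Eb ba] nb] := sup_lt sa na.
  by apply: lt_trans ba; apply: Eb.
have /choice[s sP] : forall a, exists b, a < b /\ forall n, tb a n -> h n < b.
  move=> x; have [b bP] := small_bounded hmu hlambda ha2 h (small_tbelow x).
  have [b' xb'] := no_max hmu hlambda ha2 (Order.max x b).
  move: xb'; rewrite gt_max => /andP[xb' bb']; exists b'; split=> // n /bP.
  by move=> /lt_trans; apply.
pose it (i : nat) := iter i s a.
have [b bP] : exists b, forall k : nat, setT k -> it k < b.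
  apply: (small_bounded hmu hlambda ha2).
  by apply/smallE; apply/infiniteP; case: hmu.
have [u su] : exists u, supremums (range it) u.
  by apply: (wo_sup hwo (b := b)) => _ [k _ <-]; apply/ltW/bP.
have itu (i : nat) : it i < u.
  apply: lt_le_trans (sP (it i)).1 _; apply: (sup_ge su); by exists i.+1.
exists u; last exact: (itu 0%N).
move=> n [nu Tn]; have [_ [k _ <-] nk] := sup_lt su nu.
by apply: lt_trans (itu k.+1); apply: (sP (it k)).2.
Qed.

(** Let [f] send each node to an element of [D] above it. At an ordinal [a] closed under the heights
    and codes of the nodes [f n], [D] is dense among the nodes below [a]; if (d) guesses it at [a],
    a branch following [c dl] hits [D] below [a]. *)
Lemma dense_level (D : set (L * set L)) :
  (forall n, D n -> T n.1 n.2) ->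
  (forall n, T n.1 n.2 -> exists2 m, D m & nle n m) ->
  exists dl, forall X, T dl X -> exists2 b, b < dl & D (b, X `&` below b).
Proof.
move=> DT Dd.
have /choice[f fP] : forall n, exists m, T n.1 n.2 -> D m /\ nle n m.
  move=> n; have [/Dd[m Dm nm]|] := pselect (T n.1 n.2); first by exists m.
  by exists n.
pose h n := Order.max (f n).1 (code (f n)).
have [S_AE [stat SS SP]] := hd (code @` D) (closure_club h).
have [dl [Sdl _]] := stat _ (closure_club h).
exists dl => X TX; have SSdl := SS _ Sdl.
have := TX; rewrite TE => -[_ /(_ (hb1 SSdl))] [[dl' [_ ub /(_ SSdl) E]]|[] //].
subst dl' => -[xi xidl fol].
have [xi' nxi' /andP[xx xdl]] := ub _ xidl.
(* The guessing point is taken beyond [xi'] in [nacc (c dl)], so that [xi <= q] and [follows]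
   applies at [a]. *)
have [a [na PA Ea] xa] := sup_lt (SP _ Sdl) xdl.
have adl : a < dl by have [cs _ _ _] := hb2 SSdl; apply: cs na.1.
have [q sq] := nacc_sup dl a.
have qa := nacc_sup_lt SSdl na sq.
have xq : xi <= q by apply: (le_trans (ltW xx)); apply: (sup_ge sq).
have tq : tb a (q, X `&` below q).
  by split=> //=; apply: T_restr TX (ltW (lt_trans qa adl)).
have [/= TZ _ hit] := choose_hit_spec (extension a).2 SSdl na tq.
rewrite -(fol a q) // in hit.
have [|b ba [[m Dm /code_inj E] _]] := hit _ PA.
  move=> n tn; have [_ Tn] := tn; have [Dm nm] := fP n Tn.
  have := Ea n tn; rewrite gt_max => /andP[fa ca].
  exists (f n); split=> //; first by split=> //; apply: DT.
exists b; first exact: lt_trans adl.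
move: E; rewrite restrI ?(ltW ba) // => <- //; first exact/T_sub/DT.
by move=> x [].
Qed.

(** The level [s] just above [n.1] has cofinality different from mu, so [n.2] and [n.2] with the
    point [n.1] added are both nodes there. *)
Lemma splitting n : T n.1 n.2 -> exists m m', [/\ T m.1 m.2, T m'.1 m'.2,
  nle n m, nle n m' &
  forall k : L * set L, T k.1 k.2 -> nle m k -> nle m' k -> False].
Proof.
move=> Tn; have [b nb] := no_max hmu hlambda ha2 n.1.
have [s ns mins] := wo_min hwo (A := [set x | n.1 < x]) nb.
have maxn x : x < s -> x <= n.1.
  by move=> xs; rewrite leNgt; apply/negP => /mins; rewrite leNgt xs.
have cfs : cf s <> mu.
  by move=> E; have := cf_lt_succ hwo hmu ns maxn; rewrite E ltxx.
have brs X : X `&` below n.1 = n.2 -> X `<=` below s -> T s X.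
  move=> E Xs; apply: T_cf => //; split=> // x xs; split=> //=.
  by rewrite -(restrI X (maxn _ xs)) E; apply: T_restr Tn (maxn _ xs).
have E1 : (n.2 `|` [set n.1]) `&` below n.1 = n.2.
  apply/seteqP; split=> [x [[//|->]]|x nx]; first by rewrite /below /= ltxx.
  by split; [left|apply: T_sub Tn _ nx].
have T1 : T s n.2.
  apply: brs; first exact: T_id.
  by move=> x /(T_sub Tn) xn; apply: lt_trans ns.
have T2 : T s (n.2 `|` [set n.1]).
  by apply: brs => // x [/(T_sub Tn) xn|->] //; apply: lt_trans ns.
exists (s, n.2), (s, n.2 `|` [set n.1]); split=> //.
- by split; [apply: ltW|apply: T_id].
- by split; first exact: ltW.
move=> k Tk mk mk'; have := nle_common mk mk' (lexx _).
move=> /nle_eq-/(_ T2 (lexx _)) [E].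
have /(T_sub Tn) : n.2 n.1 by rewrite E; right.
by rewrite /below /= ltxx.
Qed.

Lemma level_nonempty a : exists X, T a X.
Proof.
(* [z] is the ordinal 0, and [(z, set0)] is the root. *)
have [z _ minz] := wo_min hwo (A := setT) (a := a) I.
have T0 : T z set0.
  apply: T_cf.
    by move=> /(cf_mu_limit hwo hmu)[[b bz] _]; have := minz b I; rewrite leNgt bz.
  by split=> // b bz; have := minz b I; rewrite leNgt bz.
have := minz a I; rewrite le_eqVlt => /orP[/eqP<-|za]; first by exists set0.
by have [X TX _] := (extension a).1 (z, set0) (conj za T0); exists X.
Qed.

Lemma nodes_card : [set n : L * set L | T n.1 n.2] #= [set: L].
Proof.
apply/card_eqPle; split.
  apply/(card_le_exP _ _ (inhabits mu)); exists code; split=> // n m Tn Tm.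
  by apply: code_inj; apply: T_sub.
have /choice[X XP] := level_nonempty.
apply/(card_le_exP _ _ (inhabits (mu, set0))); exists (fun a => (a, X a)).
by split=> [a _|a b _ _ []] //; apply: XP.
Qed.

(** * Transfer to a tree on lambda; chains, antichains, completeness *)

Section Numbering.
Variable g : L -> L * set L.
Hypothesis gT : forall x, T (g x).1 (g x).2.
Hypothesis g_inj : injective g.
Hypothesis g_surj : forall n, T n.1 n.2 -> exists x, g x = n.

Definition tree_lt (x y : L) : Prop := (g x).1 < (g y).1 /\ nle (g x) (g y).

Lemma nle_tree_lt x y : nle (g x) (g y) -> x = y \/ tree_lt x y.
Proof.
move=> xy; have := xy.1; rewrite le_eqVlt => /orP[/eqP E|lt]; last by right.
by left; apply: g_inj; apply: nle_eq => //; rewrite E.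
Qed.

Lemma tree_lt_is_tree : is_tree tree_lt.
Proof.
split=> [x []|x y z [xy nxy] [yz nyz]|x X Xx [y0 Xy0]]; first by rewrite ltxx.
  by split; [apply: lt_trans yz|apply: nle_trans nyz].
have [_ [m Xm <-] minm] := wo_min hwo (A := [set (g y).1 | y in X])
  (ex_intro2 _ _ y0 Xy0 erefl).
exists m => // y Xy; have [_ mx] := Xx m Xm; have [_ yx] := Xx y Xy.
have [|->|] := @nle_tree_lt m y; [|by left|by right].
by apply: (nle_common mx yx); apply: minm; exists y.
Qed.

Lemma tree_lt_full_height : full_height tree_lt.
Proof.
have ht x : node_height tree_lt x (g x).1.
  exists (fun y => (g y).1); split.
    split.
    - by move=> y [].
    - move=> y z /set_mem[_ yx] /set_mem[_ zx] E; apply: g_inj.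
      by apply: nle_eq; rewrite ?E //; apply: (nle_common yx zx); rewrite E.
    move=> b bx.
    have [y yE] := g_surj (n := (b, (g x).2 `&` below b)) (T_restr (gT x) (ltW bx)).
    exists y; last by rewrite yE.
    by rewrite /preds /tree_lt /= yE; split=> //; apply: nle_restr; apply: ltW.
  move=> y z [_ yx] [_ zx]; split=> [[]//|lt].
  by split=> //; apply: (nle_common yx zx); apply: ltW.
split=> [x|a]; first by exists (g x).1.
have [X TX] := level_nonempty a; have [x xE] := g_surj (n := (a, X)) TX.
by exists x; have := ht x; rewrite xE.
Qed.

Lemma low_not_full (A : set L) dl : (forall x, A x -> (g x).1 < dl) ->
  ~ (A #= [set: L]).
Proof.
move=> low /card_eqPle[_ AL]; apply: (not_small_setT hlambda); apply/smallE.
apply: card_le_trans AL _; apply/smallE.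
apply: (small_inj (h := g)) (small_tbelow dl) => [x Ax|x y _ _ /g_inj //].
by split=> //; apply: low.
Qed.

(** The nodes below no element of [A] are dense: by [splitting] a node has two incompatible
    extensions, and a chain has no elements above both. An element of [A] of height at least [dl]
    would be above such a node. *)
Lemma tree_lt_chain (A : set L) : tree_chain tree_lt A -> ~ (A #= [set: L]).
Proof.
move=> Ach.
have [|n Tn|dl dlP] := @dense_level
  [set n | T n.1 n.2 /\ forall x, A x -> ~ nle n (g x)]; first by move=> n [].
  have [m [m' [Tm Tm' nm nm' inc]]] := splitting Tn.
  apply: contrapT => H.
  have in_A (k : L * set L) : T k.1 k.2 -> nle n k -> exists2 x, A x & nle k (g x).
    move=> Tk nk; apply: contrapT => H'; apply: H; exists k => //; split=> //.
    by move=> x Ax kx; apply: H'; exists x.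
  have [x Ax mx] := in_A m Tm nm; have [y Ay my] := in_A m' Tm' nm'.
  case: (Ach x y Ax Ay) => [E|[_ xy]|[_ yx]].
  - by rewrite E in mx; apply: inc mx my.
  - by apply: inc (nle_trans mx xy) my.
  - by apply: inc mx (nle_trans my yx).
apply: (@low_not_full _ dl) => x Ax; rewrite ltNge; apply/negP => dlx.
have [b bdl [_ /(_ x Ax)]] := dlP _ (T_restr (gT x) dlx); apply.
rewrite restrI ?(ltW bdl) //; apply: nle_restr; exact: le_trans (ltW bdl) dlx.
Qed.

Lemma tree_lt_antichain (A : set L) : tree_antichain tree_lt A ->
  ~ (A #= [set: L]).
Proof.
move=> Aan.
have [|n Tn|dl dlP] := @dense_level [set n | T n.1 n.2 /\
    ((exists2 x, A x & nle (g x) n) \/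
     forall x (k : L * set L), A x -> T k.1 k.2 -> nle n k -> ~ nle (g x) k)].
- by move=> n [].
- have [[x [k [Ax Tk nk xk]]]|H] := pselect (exists x (k : L * set L),
    [/\ A x, T k.1 k.2, nle n k & nle (g x) k]).
    by exists k => //; split=> //; left; exists x.
  exists n; last exact: nle_refl.
  by split=> //; right=> x k Ax Tk nk xk; apply: H; exists x, k.
apply: (@low_not_full _ dl) => x Ax; rewrite ltNge; apply/negP => dlx.
have [b bdl] := dlP _ (T_restr (gT x) dlx).
rewrite restrI ?(ltW bdl) //; set m := (b, _).
have bx : b < (g x).1 by apply: lt_le_trans dlx.
have mx : nle m (g x) by apply/nle_restr/ltW.
(* An element of [A] below [m] is strictly below [x], against the antichain property; and [x] itself
   refutes that [m] is incompatible with all of [A]. *)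
move=> [_ [[y Ay ym]|/(_ x (g x) Ax (gT x) mx)]]; last by case; apply: nle_refl.
have yx : tree_lt y x.
  by split; [apply: le_lt_trans ym.1 bx|apply: nle_trans mx].
apply: (Aan y x) => //; last by apply: Or32.
by move=> E; case: yx; rewrite E ltxx.
Qed.

Lemma tree_lt_complete : complete_tree mu tree_lt.
Proof.
move=> k km s sinc.
have [[z0 z0k]|H] := pselect (exists z, z < k); last first.
  by exists mu => i ik; case: H; exists i.
(* The first node of the sequence serves as the lower bound [n0] of [short_chain]. *)
have [z zk minz] := wo_min hwo (A := below k) z0k.
have [||n [Tn _ sn _ _]] := @short_chain k (g \o s) (g (s z)) km (gT _).
- move=> j jk; split; first exact: gT.
  have := minz j jk; rewrite le_eqVlt => /orP[/eqP<-|zj]; first exact: nle_refl.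
  by have [] := sinc z j zj jk.
- by move=> i j ij jk; have [] := sinc i j ij jk.
have [x xE] := g_surj Tn; exists x => i ik; apply: nle_tree_lt.
by rewrite xE; apply: sn.
Qed.

End Numbering.

Lemma souslin_exists : exists R : L -> L -> Prop,
  souslin_tree R /\ complete_tree mu R.
Proof.
have [g [gT ginj gsurj]] := card_eq_exP (inhabits (mu, set0))
  (eq_trans (card_eq_sym _ _) nodes_card).
have gT' x : T (g x).1 (g x).2 by apply: gT.
have ginj' : injective g by move=> x y; apply: ginj; apply: mem_set.
have gsurj' n : T n.1 n.2 -> exists x, g x = n by move=> /gsurj[x _ <-]; exists x.
exists (tree_lt g); split; last exact: tree_lt_complete.
split.
- exact: tree_lt_is_tree.
- exact: tree_lt_full_height.
- by move=> A; apply: tree_lt_chain.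
- by move=> A; apply: tree_lt_antichain.
Qed.

End Levels.

Theorem theorem2 (d : Order.disp_t) (L : orderType d) (mu : L)
  (hwo : well_ordered L)
  (hmu : infinite_cardinal mu)
  (hlambda : is_successor_cardinal mu)
  (Sstar : set L) (c : L -> set L) (P : L -> L -> set (set L))
  (ha1 : [set: L] #= [set X : set L | X `<=` below mu])
  (ha2 : [set: short_sequences mu] #= below mu)
  (hb1 : forall delta : L, Sstar delta -> cf delta = mu)
  (hb2 : forall delta : L, Sstar delta ->
     [/\ c delta `<=` below delta,
         supremums (c delta) delta,
         closed_in (c delta) delta
       & forall a : L, c delta a -> limit_ordinal a])
  (hc : forall delta a : L, Sstar delta -> nacc (c delta) a ->
     [/\ forall X : set L, P delta a X -> X `<=` below a,
         P delta a #<= below (cf a)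
       & Sstar a -> card_lt (P delta a) (below mu)])
  (hd : forall A E : set L, club E ->
     exists S_AE : set L,
       [/\ stationary S_AE,
           S_AE `<=` Sstar
         & forall delta : L, S_AE delta ->
             supremums [set a | [/\ nacc (c delta) a,
                                    P delta a (A `&` below a)
                                  & E a]] delta])
  (he : forall delta deltastar : L, Sstar delta -> Sstar deltastar ->
     acc (c deltastar) delta ->
     exists2 a : L, a < delta &
       nacc (c delta) `&` [set b | a < b < delta]
         = nacc (c deltastar) `&` [set b | a < b < delta] /\
       forall b : L, nacc (c delta) b -> a < b < delta ->
         P delta b = P deltastar b)
  (hf : forall gamma : L,
     [set restr_seq c P delta gamma | delta in Sstar] #<= below mu) :
  exists T : L -> L -> Prop, souslin_tree T /\ complete_tree mu T.
Proof.
have [code code_inj] := node_code hmu hlambda ha1 ha2.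
have [T TE] := levels_exist mu Sstar c P code hwo.
exact: (souslin_exists hwo hmu hlambda ha2 TE hb1 hb2 hc he hf code_inj hd).
Qed.
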